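(* Assume $S(A,b)\neq\emptyset$ and let $\hat x=(1,1,\dots,1)\in[0,1]^n$. The system $\sum_{j\in J}T_L(a_{ij},x_j)\ge b_i$ $(i\in I)$ has a unique minimal solution if and only if $(\delta_1(\hat x),\delta_2(\hat x),\dots,\delta_n(\hat x))\in S(A,b)$. Moreover, in that case $(\delta_1(\hat x),\delta_2(\hat x),\dots,\delta_n(\hat x))$ is the unique minimal solution.
   Context: Let $I=\{1,\dots,m\}$, $J=\{1,\dots,n\}$, $A=(a_{ij})_{m\times n}$ with $a_{ij}\in[0,1]$, and $b=(b_1,\dots,b_m)$ with $b_i>0$ real. The Łukasiewicz t-norm is $T_L(a,x)=\max\{a+x-1,0\}$ on $[0,1]^2$. The solution set is $S(A,b)=\{x\in[0,1]^n : \sum_{j\in J}T_L(a_{ij},x_j)\ge b_i \text{ for all } i\in I\}$. Vectors are ordered componentwise. A solution $\check x\in S(A,b)$ is minimal if $x\in S(A,b)$ and $x\le\check x$ imply $x=\check x$. For $x\in S(A,b)$ and $j\in J$, define $F_j(x)=\{t\in[0,1] : T_L(a_{ij},t)+\sum_{k\in J\setminus\{j\}}T_L(a_{ik},x_k)\ge b_i \text{ for all } i\in I\}$ and $\delta_j(x)=\min F_j(x)$. (If $S(A,b)\ne\emptyset$ then $\hat x\in S(A,b)$.) *)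

(* Defs.v *)
From mathcomp Require Import all_boot all_order all_algebra.
From mathcomp Require Import boolp classical_sets reals.
Set Implicit Arguments.
Unset Strict Implicit.
Unset Printing Implicit Defensive.
Import Order.TTheory GRing.Theory Num.Theory.
Local Open Scope classical_set_scope.
Local Open Scope ring_scope.

Definition tluk (R : realType) (a x : R) : R := Num.max (a + x - 1) 0.

Definition sol_set (R : realType) (m n : nat) (A : 'M[R]_(m, n)) (b : 'rV[R]_m)
    : set 'rV[R]_n :=
  [set x | (forall j, 0 <= x 0 j <= 1)
           /\ (forall i, b 0 i <= \sum_(j < n) tluk (A i j) (x 0 j))].

Definition lev (R : realType) (n : nat) (x y : 'rV[R]_n) : Prop :=
  forall j, x 0 j <= y 0 j.

Definition minimal_solution (R : realType) (m n : nat) (A : 'M[R]_(m, n))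
    (b : 'rV[R]_m) (c : 'rV[R]_n) : Prop :=
  sol_set A b c /\ (forall x, sol_set A b x -> lev x c -> x = c).

Definition Fset (R : realType) (m n : nat) (A : 'M[R]_(m, n)) (b : 'rV[R]_m)
    (x : 'rV[R]_n) (j : 'I_n) : set R :=
  [set t | 0 <= t <= 1
           /\ (forall i, b 0 i <= tluk (A i j) t
                          + \sum_(k < n | k != j) tluk (A i k) (x 0 k))].

Definition is_min (R : realType) (E : set R) (t : R) : Prop :=
  E t /\ lbound E t.

(* The value 0 is returned only when [E] has no least element. *)
Definition set_min (R : realType) (E : set R) : R := xget 0 [set t | is_min E t].

Definition delta (R : realType) (m n : nat) (A : 'M[R]_(m, n)) (b : 'rV[R]_m)
    (x : 'rV[R]_n) (j : 'I_n) : R := set_min (Fset A b x j).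

Definition delta_vec (R : realType) (m n : nat) (A : 'M[R]_(m, n))
    (b : 'rV[R]_m) (x : 'rV[R]_n) : 'rV[R]_n := \row_(j < n) delta A b x j.

Definition xhat (R : realType) (n : nat) : 'rV[R]_n := const_mx 1.

(* Main.v *)
(* Every solution [z] below [x] satisfies [z_j \in F_j(x)], so delta(xhat) lies
   below all solutions; if it is itself a solution, it is the least one.
   Conversely, lowering the coordinates of a solution [x] one after the other to
   [delta_j] yields a minimal solution below [x].  Applied to [xhat] with its
   [j]-th entry replaced by [delta_j(xhat)], this shows that a unique minimal
   solution has [j]-th entry at most [delta_j(xhat)], for every [j]; hence it
   equals delta(xhat). *)
Require Import Defs.
From mathcomp Require Import all_boot all_order all_algebra.
From mathcomp Require Import boolp classical_sets reals.
From mathcomp Require Import lra.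
Set Implicit Arguments.
Unset Strict Implicit.
Import Order.TTheory GRing.Theory Num.Theory.
Local Open Scope classical_set_scope.
Local Open Scope ring_scope.

Lemma tluk_homo (R : realType) (a x y : R) : x <= y -> tluk a x <= tluk a y.
Proof. by move=> xy; rewrite /tluk ge_max !le_max lexx orbT lerB // lerD2l xy. Qed.

(** A positive threshold is never reached by the branch 0 of the maximum, so only the linear branch
    counts. *)
Lemma le_tlukP (R : realType) (a t c : R) : 0 < c -> (c <= tluk a t) = (c + 1 - a <= t).
Proof.
move=> c0; rewrite /tluk le_max [c <= 0]leNgt c0 orbF.
by apply/idP/idP; lra.
Qed.

Lemma lev_refl (R : realType) (n : nat) (x : 'rV[R]_n) : lev x x.
Proof. by move=> j. Qed.

Lemma lev_trans (R : realType) (n : nat) (x y z : 'rV[R]_n) : lev x y -> lev y z -> lev x z.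
Proof. by move=> xy yz j; exact: le_trans (xy j) (yz j). Qed.

Lemma lev_anti (R : realType) (n : nat) (x y : 'rV[R]_n) : lev x y -> lev y x -> x = y.
Proof. by move=> xy yx; apply/rowP => j; apply/le_anti; rewrite xy yx. Qed.

Lemma Fset_has_min (R : realType) (m n : nat) (A : 'M[R]_(m, n)) (b : 'rV[R]_m)
    (x : 'rV[R]_n) (j : 'I_n) :
  Fset A b x j !=set0 -> exists t, is_min (Fset A b x j) t.
Proof.
case=> s hs; have [/andP[_ s1] _] := hs.
pose c i := b 0 i - \sum_(k < n | k != j) tluk (A i k) (x 0 k).
(* [t] belongs to [Fset A b x j] iff [t] is in [0, 1] and [c i + 1 - A i j <= t]
   for the rows [i] with [0 < c i], the other rows being satisfied by any [t]. *)
have min_le t : Fset A b x j t ->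
    \big[Num.max/0]_(i < m | 0 < c i) (c i + 1 - A i j) <= t.
  move=> [/andP[t0 _] ht]; apply: bigmax_le => // i ci.
  by rewrite -le_tlukP // lerBlDr.
exists (\big[Num.max/0]_(i < m | 0 < c i) (c i + 1 - A i j)); split; last exact: min_le.
split=> [|i].
  (* The base value 0 of the maximum gives the lower bound; the upper bound holds because the given
     member [s] dominates the maximum. *)
  rewrite bigmax_ge_id /=; apply: le_trans s1.
  exact: min_le.
rewrite -lerBlDr -/(c i); case: (ltP 0 (c i)) => ci.
  by rewrite le_tlukP //; apply: (le_bigmax_cond _ (fun i => c i + 1 - A i j)).
by apply: le_trans ci _; rewrite /tluk le_max lexx orbT.
Qed.

Lemma deltaP (R : realType) (m n : nat) (A : 'M[R]_(m, n)) (b : 'rV[R]_m)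
    (x : 'rV[R]_n) (j : 'I_n) :
  Fset A b x j !=set0 -> is_min (Fset A b x j) (delta A b x j).
Proof. by move/Fset_has_min => [t ht]; apply: (xgetPex 0); exists t. Qed.

(** Raising the entries other than [j] from [y] to [x] only increases each row sum, as [tluk] is
    monotone. *)
Lemma sol_Fset (R : realType) (m n : nat) (A : 'M[R]_(m, n)) (b : 'rV[R]_m)
    (x y : 'rV[R]_n) (j : 'I_n) :
  (forall k, k != j -> y 0 k <= x 0 k) -> sol_set A b y -> Fset A b x j (y 0 j).
Proof.
move=> yx [y01 hy]; split=> [|i]; first exact: y01.
apply: le_trans (hy i) _; rewrite (bigD1 j) //= lerD2l.
by apply: ler_sum => k kj; apply/tluk_homo/yx.
Qed.

Lemma sol_delta (R : realType) (m n : nat) (A : 'M[R]_(m, n)) (b : 'rV[R]_m)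
    (x : 'rV[R]_n) (j : 'I_n) :
  sol_set A b x -> is_min (Fset A b x j) (delta A b x j).
Proof. by move=> xS; apply: deltaP; exists (x 0 j); exact: sol_Fset. Qed.

Definition lower (R : realType) (m n : nat) (A : 'M[R]_(m, n)) (b : 'rV[R]_m)
    (x : 'rV[R]_n) (j : 'I_n) : 'rV[R]_n :=
  \row_k if k == j then delta A b x j else x 0 k.

Lemma lower_sol (R : realType) (m n : nat) (A : 'M[R]_(m, n)) (b : 'rV[R]_m)
    (x : 'rV[R]_n) (j : 'I_n) : sol_set A b x -> sol_set A b (lower A b x j).
Proof.
move=> xS; have [[d01 hd] _] := sol_delta j xS; split=> [k|i].
  by rewrite mxE; case: eqP => // _; exact: (proj1 xS).
apply: le_trans (hd i) _; rewrite [leRHS](bigD1 j) //= mxE eqxx lerD2l.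
by apply: ler_sum => k /negPf kj; rewrite mxE kj.
Qed.

Lemma lower_lev (R : realType) (m n : nat) (A : 'M[R]_(m, n)) (b : 'rV[R]_m)
    (x : 'rV[R]_n) (j : 'I_n) : sol_set A b x -> lev (lower A b x j) x.
Proof.
move=> xS k; rewrite mxE; case: eqP => // ->.
by apply: (proj2 (sol_delta j xS)); exact: sol_Fset.
Qed.

Lemma minimal_below (R : realType) (m n : nat) (A : 'M[R]_(m, n)) (b : 'rV[R]_m)
    (x : 'rV[R]_n) :
  sol_set A b x -> exists2 c, minimal_solution A b c & lev c x.
Proof.
move=> xS.
(* Once lowered, a coordinate can no longer decrease, even after further
   coordinates have been lowered. *)
have descent (s : seq 'I_n) : exists y, [/\ sol_set A b y, lev y x &
    forall j, j \in s -> forall z, sol_set A b z -> lev z y -> y 0 j <= z 0 j].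
  elim: s => [|j s [y [yS yx ys]]]; first by exists x; split=> //; exact: lev_refl.
  have yy := lower_lev j yS.
  exists (lower A b y j); split=> [||k]; [exact: lower_sol | exact: lev_trans yx |].
  rewrite in_cons => kjs z zS zy; have zley := lev_trans zy yy.
  have [kj|kj] := eqVneq k j; last first.
    (* For an earlier coordinate, [z] also lies below [y], so the invariant of [y] applies. *)
    by apply: le_trans (yy k) _; apply: ys => //; move: kjs; rewrite (negPf kj).
  (* For the new coordinate, [z] below [y] puts its [j]-th entry in [Fset A b y j], whose minimum is
     the lowered value. *)
  rewrite mxE kj eqxx; apply: (proj2 (sol_delta j yS)).
  by apply: sol_Fset => // l _; exact: zley.
have [c [cS cx hc]] := descent (enum 'I_n).
exists c => //; split=> // z zS zc.
by apply: lev_anti => // j; apply: hc => //; rewrite mem_enum.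
Qed.

Lemma sol_xhat (R : realType) (m n : nat) (A : 'M[R]_(m, n)) (b : 'rV[R]_m) :
  sol_set A b !=set0 -> sol_set A b (xhat R n).
Proof.
case=> x [x01 hx]; split=> [j|i]; first by rewrite mxE ler01 lexx.
apply: le_trans (hx i) _; apply: ler_sum => j _.
by apply: tluk_homo; rewrite mxE; case/andP: (x01 j).
Qed.

Lemma delta_xhat_lev (R : realType) (m n : nat) (A : 'M[R]_(m, n)) (b : 'rV[R]_m)
    (x : 'rV[R]_n) : sol_set A b x -> lev (delta_vec A b (xhat R n)) x.
Proof.
move=> xS j; have hS : sol_set A b !=set0 by exists x.
rewrite mxE; apply: (proj2 (sol_delta j (sol_xhat hS))).
by apply: sol_Fset => // k _; rewrite mxE; case/andP: (proj1 xS k).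
Qed.

Theorem corollary3p1 (R : realType) (m n : nat)
    (A : 'M[R]_(m, n)) (b : 'rV[R]_m)
    (hA : forall i j, 0 <= A i j <= 1)
    (hb : forall i, 0 < b 0 i)
    (hS : sol_set A b !=set0) :
  ((exists! x : 'rV[R]_n, minimal_solution A b x)
     <-> sol_set A b (delta_vec A b (xhat R n)))
  /\ (sol_set A b (delta_vec A b (xhat R n)) ->
      unique (minimal_solution A b) (delta_vec A b (xhat R n))).
Proof.
have least : sol_set A b (delta_vec A b (xhat R n)) ->
    unique (minimal_solution A b) (delta_vec A b (xhat R n)).
  move=> dS; split=> [|c [cS hc]]; last by apply: hc => //; exact: delta_xhat_lev.
  by split=> // x xS xd; apply: lev_anti => //; exact: delta_xhat_lev.
split=> //; split=> [[u [[uS _] uniq_u]]|/least du]; last by exists (delta_vec A b (xhat R n)).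
suff <- : u = delta_vec A b (xhat R n) by [].
apply: lev_anti; last exact: delta_xhat_lev.
(* The minimal solution [c] is chosen anew for each [j], but uniqueness identifies it with [u] every
   time; only its [j]-th entry is compared. *)
move=> j; have [c /uniq_u <- /(_ j)] := minimal_below (lower_sol j (sol_xhat hS)).
by rewrite !mxE eqxx.
Qed.
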